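(* Let $H$ be a bipartite graph with bipartition $(X,Y)$, and let $k=|X|$ and $\ell = |Y|$. Suppose $\ell = \alpha(H)$. Then for all integers $n \ge k+\ell$, $$\mathrm{sat}^*(n,H)\le \left(k-1+\frac{(k(k-1)+1)(\ell-1)}{2}\right)n-\frac{(k(k-1)^2+1)(\ell-1)+k(k-1)}{2}.$$
   Context: All graphs are finite and simple; $\alpha(H)$ denotes the independence number of $H$. An edge-colouring of a graph is proper if incident edges receive different colours, and a subgraph is rainbow if all of its edges receive pairwise distinct colours. A graph $G$ is properly rainbow $H$-saturated if (1) there is a proper edge-colouring of $G$ (with any set of colours) containing no rainbow copy of $H$, and (2) for every edge $e$ of the complement $\overline{G}$, every proper edge-colouring of $G+e$ contains a rainbow copy of $H$. The proper rainbow saturation number $\mathrm{sat}^*(n,H)$ is the minimum number of edges in an $n$-vertex properly rainbow $H$-saturated graph.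
   Formalization: Assumes k ≥ 1 (for k = 0, H is edgeless and sat* is undefined) and excludes H = P_3 (k = 1, ℓ = 2, two edges) with n even, where sat*(n,H) = n/2 exceeds the stated bound (n−1)/2. *)

(* Defs.v *)
From mathcomp Require Import all_boot.

Set Implicit Arguments.
Unset Strict Implicit.
Unset Printing Implicit Defensive.

Record graph (T : finType) := Graph {
  adj :> rel T;
  adj_sym : symmetric adj;
  adj_irr : irreflexive adj
}.

Section Graphs.
Variable T : finType.
Implicit Types (G : graph T) (S : {set T}).

Definition edges G : {set {set T}} :=
  [set e : {set T} | [exists u, exists v, adj G u v && (e == [set u; v])]].

Definition independent G S := [forall u in S, forall v in S, ~~ adj G u v].

Definition alpha G := \max_(S : {set T} | independent G S) #|S|.

Definition bipartition G (X Y : {set T}) :=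
  [/\ [disjoint X & Y], X :|: Y = [set: T], independent G X & independent G Y].

Section AddEdge.
Variables (G : graph T) (u v : T).

Definition add_edge_rel : rel T :=
  fun x y => adj G x y || (x != y) && ([set x; y] == [set u; v]).

Lemma add_edge_sym : symmetric add_edge_rel.
Proof. by move=> x y; rewrite /add_edge_rel adj_sym eq_sym setUC. Qed.

Lemma add_edge_irr : irreflexive add_edge_rel.
Proof. by move=> x; rewrite /add_edge_rel adj_irr eqxx. Qed.

Definition add_edge : graph T := Graph add_edge_sym add_edge_irr.
End AddEdge.

(* A colouring is a total function on vertex sets; only its values on the
   edges of G matter. *)
Definition proper_colouring G (C : Type) (c : {set T} -> C) : Prop :=
  forall e f, e \in edges G -> f \in edges G ->
    e != f -> e :&: f != set0 -> c e <> c f.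
End Graphs.

(* The copy of H given by phi has edge set [set phi @: e | e in edges H]. *)
Definition rainbow_copy (V T : finType) (H : graph V) (G : graph T)
    (C : Type) (c : {set T} -> C) (phi : V -> T) : Prop :=
  [/\ injective phi,
      forall u v, adj H u v -> adj G (phi u) (phi v) &
      forall e f, e \in edges H -> f \in edges H ->
        e != f -> c (phi @: e) <> c (phi @: f)].

Definition has_rainbow_copy (V T : finType) (H : graph V) (G : graph T)
    (C : Type) (c : {set T} -> C) : Prop :=
  exists phi : V -> T, rainbow_copy H G c phi.

Definition properly_rainbow_saturated (V T : finType) (H : graph V)
    (G : graph T) : Prop :=
  (exists (C : Type) (c : {set T} -> C),
     proper_colouring G c /\ ~ has_rainbow_copy H G c) /\
  (forall u v : T, u != v -> ~~ adj G u v ->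
     forall (C : Type) (c : {set T} -> C),
       proper_colouring (add_edge G u v) c ->
       has_rainbow_copy H (add_edge G u v) c).

(* [is_sat_star n H m] says that sat^*(n, H) is defined and equal to m. It is
   a relation because no saturated graph exists when H has no edge and
   #|V| <= n. *)
Definition is_sat_star (n : nat) (V : finType) (H : graph V) (m : nat) : Prop :=
  (exists2 G : graph 'I_n, properly_rainbow_saturated H G & #|edges G| = m) /\
  (forall G : graph 'I_n, properly_rainbow_saturated H G -> m <= #|edges G|).

(* Main.v *)
Require Import Defs.
From mathcomp Require Import all_boot all_order all_algebra.
From mathcomp Require Import zify lra.
From mathcomp Require boolp.

(* Any graph with a rainbow-free proper colouring extends greedily to a saturated
   one, so it suffices to start from a graph that bounds the degrees of all its
   rainbow-free extensions. For k >= 2 start from K_{k-1} joined to an independent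
   set: it has no copy of H, since deleting k-1 vertices of H never leaves an
   independent set. In a rainbow-free extension a vertex v outside the core K has
   at most (k(k-1)+1)(l-1) neighbours outside K; otherwise l of them could be
   chosen greedily to form a rainbow K_{k,l} with K + v. For k = 1 the graph H is
   a star plus isolated vertices and rainbow-freeness is a degree bound; when the
   star has l leaves, start from an (l-1)-regular circulant on all but one or two
   vertices. *)

Set Implicit Arguments.
Unset Strict Implicit.
Unset Printing Implicit Defensive.
Import Order.TTheory GRing.Theory Num.Theory.
Local Open Scope ring_scope.

Definition neighbours (T : finType) (G : graph T) (v : T) : {set T} :=
  [set w | adj G v w].

Definition rainbow_free (V T : finType) (H : graph V) (G : graph T) : Prop :=
  exists (C : Type) (c : {set T} -> C),
    proper_colouring G c /\ ~ has_rainbow_copy H G c.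

(** * Injections and greedy selection in finite sets *)

Section FiniteSets.
Local Open Scope nat_scope.

Lemma exists_injection (S T : finType) (A : {set S}) (B : {set T}) (t0 : T) :
  #|A| <= #|B| ->
  exists2 f : S -> T, {in A &, injective f} & {in A, forall a, f a \in B}.
Proof.
rewrite [#|A|]cardE [#|B|]cardE => leAB.
have idx a : a \in A -> index a (enum A) < size (enum B).
  by move=> aA; apply: leq_trans leAB; rewrite index_mem mem_enum.
exists (fun a => nth t0 (enum B) (index a (enum A))) => [a b aA bA /eqP|a aA].
  rewrite nth_uniq ?enum_uniq ?idx // => /eqP; apply: (@index_inj _ a (enum A));
    by rewrite mem_enum.
by rewrite -mem_enum mem_nth ?idx.
Qed.

(** The complement of [A] injects into the complement of the image of [A]. This places the vertices
    of a star-like [H] that lie off the star. *)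
Lemma injection_extension (V T : finType) (A : {set V}) (f : V -> T) (t0 : T) :
  {in A &, injective f} -> #|V| <= #|T| ->
  exists2 g : V -> T, injective g & {in A, g =1 f}.
Proof.
move=> injf leVT.
have [|g injg gB] := @exists_injection _ _ (~: A) (~: (f @: A)) t0.
  by have := cardsC A; have := cardsC (f @: A); rewrite card_in_imset //; lia.
exists (fun v => if v \in A then f v else g v) => [u v|v ->] //.
have nfg a b : a \in A -> b \notin A -> f a <> g b.
  move=> aA bA fg; have : g b \in ~: (f @: A) by apply: gB; rewrite inE.
  by rewrite -fg inE imset_f.
case: ifPn => uA; case: ifPn => vA; first exact: injf.
- by move/nfg; case.
- by move/esym/nfg; case.
- by apply: injg; rewrite inE.
Qed.

Lemma card_bigcup_le (I T : finType) (P : pred I) (F : I -> {set T}) :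
  #|\bigcup_(i | P i) F i| <= \sum_(i | P i) #|F i|.
Proof.
elim/big_rec2: _ => [|i m B _ le_Bm]; first by rewrite cards0.
by rewrite (leq_trans (leq_card_setU _ _)) // leq_add2l.
Qed.

(** Pick any [w] in [W], discard it with its at most [d] conflicting elements, and recurse. The size
    hypothesis says |W| > (d+1)(l-1), written without subtraction so that it also makes sense for l
    = 0. *)
Lemma greedy_independent (T : finType) (r : rel T) (d l : nat) (W : {set T}) :
  symmetric r ->
  {in W, forall w, #|[set w' in W | r w w']| <= d} ->
  d.+1 * l < #|W| + d.+1 ->
  exists L : {set T}, [/\ L \subset W, #|L| = l &
    {in L &, forall w w', w != w' -> ~~ r w w'}].
Proof.
move=> rsym; elim: l W => [|l IHl] W degW.
  by move=> _; exists set0; split; rewrite ?sub0set ?cards0 // => w; rewrite inE.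
rewrite mulnS addnC ltn_add2r => ltW.
have [w wW] : exists w, w \in W by apply/card_gt0P; apply: leq_trans ltW.
pose N := w |: [set w' in W | r w w'].
have leN : #|N| <= d.+1.
  by rewrite cardsU1 -(add1n d) leq_add ?degW // leq_b1.
have [||L [LW cardL indL]] := IHl (W :\: N).
- move=> w' /setDP[w'W _]; apply: leq_trans (degW _ w'W).
  by apply/subset_leq_card/subsetP=> z; rewrite !inE => /andP[/andP[_ ->] ->].
- have := cardsD W N; have := subset_leq_card (subsetIr W N).
  by move: leN ltW; lia.
exists (w |: L); split.
- by rewrite subUset sub1set wW (subset_trans LW) ?subsetDl.
- rewrite cardsU1 cardL; case: (boolP (w \in L)) => // wL.
  by have := subsetP LW _ wL; rewrite !inE eqxx.
- have nr z : z \in L -> ~~ r w z.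
    move=> /(subsetP LW); rewrite !inE negb_or negb_and.
    by case/andP=> /andP[_ /orP[/negP|//]] nW zW; case: nW.
  move=> a b; rewrite !inE => /orP[/eqP->|aL] /orP[/eqP->|bL] neq.
  + by rewrite eqxx in neq.
  + exact: nr.
  + by rewrite rsym nr.
  + exact: indL.
Qed.

End FiniteSets.

(** * Edges, rainbow-free graphs and saturation *)

Section Graphs.
Local Open Scope nat_scope.
Variables (V T : finType) (H : graph V).

Lemma edgesP (G : graph T) (e : {set T}) :
  reflect (exists u v, adj G u v /\ e = [set u; v]) (e \in edges G).
Proof.
rewrite inE; apply: (iffP existsP) => [[u /existsP[v /andP[Guv /eqP->]]]|].
  by exists u, v.
by move=> [u [v [Guv ->]]]; exists u; apply/existsP; exists v; rewrite Guv eqxx.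
Qed.

Lemma mem_edges (G : graph T) (u v : T) : ([set u; v] \in edges G) = adj G u v.
Proof.
apply/edgesP/idP => [[a [b [Gab eq_e]]]|Guv]; last by exists u, v.
have neq : a != b by apply: contraTneq Gab => ->; rewrite adj_irr.
have : a \in [set u; v] by rewrite eq_e set21.
have : b \in [set u; v] by rewrite eq_e set22.
rewrite !inE => /orP[]/eqP eb /orP[]/eqP ea; rewrite ea eb ?eqxx // in neq Gab *.
by rewrite adj_sym.
Qed.

Lemma imset_pair (S : finType) (f : S -> T) (u v : S) :
  f @: [set u; v] = [set f u; f v].
Proof. by rewrite imsetU1 imset_set1. Qed.

(** Incident pairs of an edge and a vertex are counted twice: each edge has two ends, and each edge
    at [v] is [[set v; w]] for some neighbour [w]. *)
Lemma edges_le_sum_degrees (G : graph T) :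
  (#|edges G|).*2 <= \sum_v #|neighbours G v|.
Proof.
have -> : (#|edges G|).*2 = \sum_(e in edges G) \sum_(v in e) 1.
  rewrite -muln2 -sum_nat_const; apply: eq_bigr => e /edgesP[u [v [Guv ->]]].
  rewrite sum1_card cards2; case: eqVneq => // uv.
  by rewrite uv adj_irr in Guv.
rewrite (exchange_big_dep predT) //=; apply: leq_sum => v _.
rewrite sum1dep_card; apply: leq_trans (leq_imset_card (fun w => [set v; w]) _).
apply/subset_leq_card/subsetP=> e; rewrite inE => /andP[/edgesP[a [b [Gab ->]]]].
rewrite !inE => /orP[]/eqP->; first by apply: imset_f; rewrite inE.
by rewrite setUC; apply: imset_f; rewrite inE adj_sym.
Qed.

(** Any proper colouring is a witness; here every edge is its own colour. *)
Lemma rainbow_free_no_copy (G : graph T) :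
  (forall phi : V -> T, injective phi ->
     (forall u v, adj H u v -> adj G (phi u) (phi v)) -> False) ->
  rainbow_free H G.
Proof.
move=> nocopy; exists {set T}, id; split=> [e f _ _ /eqP //|[phi [inj hom _]]].
exact: nocopy inj hom.
Qed.

(* A maximal rainbow-free supergraph is saturated. *)
Lemma saturated_extension (G0 : graph T) : rainbow_free H G0 ->
  exists2 G : graph T, properly_rainbow_saturated H G &
    forall u v, adj G0 u v -> adj G u v.
Proof.
(* Induction on the number of ordered non-adjacent pairs, which drops with every added edge. *)
have [m] := ubnP #|[set p : T * T | ~~ adj G0 p.1 p.2]|.
elim: m G0 => // m IHm G0 ltm free0.
have [sat|nsat] := boolp.pselect (properly_rainbow_saturated H G0).
  by exists G0.
have [u [v [neq nadj freeA]]] : exists u v,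
    [/\ u != v, ~~ adj G0 u v & rainbow_free H (add_edge G0 u v)].
  apply: boolp.contrapT => none; apply: nsat; split=> // u v neq nadj C c prop.
  apply: boolp.contrapT => ncopy; apply: none; exists u, v; split=> //.
  by exists C, c.
have [|G satG subG] := IHm (add_edge G0 u v) _ freeA.
  rewrite ltnS in ltm; apply: leq_trans ltm; apply/proper_card/properP; split.
    by apply/subsetP=> -[x y]; rewrite !inE /= negb_or => /andP[].
  exists (u, v); first by rewrite inE.
  by rewrite inE /= /add_edge_rel neq eqxx orbT.
by exists G => // x y Gxy; apply: subG; rewrite /= /add_edge_rel Gxy.
Qed.

Lemma saturated_free (G : graph T) :
  properly_rainbow_saturated H G -> rainbow_free H G.
Proof. by case. Qed.

End Graphs.

(** Descent on the number of edges reaches a minimum, so a single saturated graph yields both the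
    existence of the saturation number and an upper bound for it. *)
Lemma is_sat_star_le (n : nat) (V : finType) (H : graph V) (G : graph 'I_n) :
  properly_rainbow_saturated H G ->
  exists2 m, is_sat_star n H m & (m <= #|edges G|)%N.
Proof.
have [m] := ubnP #|edges G|; elim: m G => // m IHm G ltm satG.
have [[G' satG' ltG']|nsmaller] := boolp.EM
  (exists2 G' : graph 'I_n, properly_rainbow_saturated H G' & (#|edges G'| < #|edges G|)%N).
  have [||m' satm' lem'] := IHm G' => //; first exact: leq_trans ltG' _.
  by exists m' => //; apply: leq_trans lem' (ltnW ltG').
exists #|edges G| => //; split=> [|G' satG']; first by exists G.
by rewrite leqNgt; apply/negP => ltG'; apply: nsmaller; exists G'.
Qed.

(** * Rainbow copies inside properly coloured complete bipartite graphs *)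

Section Bipartite.
Local Open Scope nat_scope.
Variables (V T : finType) (H : graph V) (X Y : {set V}).
Hypothesis bipXY : bipartition H X Y.

Lemma bipartition_edges (e : {set V}) : e \in edges H ->
  exists x y, [/\ x \in X, y \in Y & e = [set x; y]].
Proof.
case: bipXY => _ covXY indX indY /edgesP[u [v [Huv ->]]].
have ind S : independent H S -> (u \in S) && (v \in S) = false.
  move=> /forallP /(_ u) /implyP indS; apply/negP => /andP[/indS /forallP].
  by move=> /(_ v) /implyP indSu /indSu; rewrite Huv.
have cov w : (w \in X) || (w \in Y) by rewrite -in_setU covXY inE.
case/orP: (cov u) (ind X indX) (ind Y indY) => uS.
  rewrite uS /= => vX _; exists u, v; split=> //.
  by have := cov v; rewrite vX.
rewrite uS /= => _ vY; exists v, u; split=> //; last by rewrite setUC.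
by have := cov v; rewrite vY orbF.
Qed.

Lemma bipartition_notin (v : V) : v \in Y = (v \notin X).
Proof.
case: bipXY => /pred0P disj covXY _ _.
have : v \in X :|: Y by rewrite covXY inE.
by have /= := disj v; rewrite inE; case: (v \in X); case: (v \in Y).
Qed.

(* Two edges a w and b w' of a complete bipartite graph are in conflict if they
   are disjoint and have the same colour; a given w conflicts with at most one
   w' for each pair a <> b. *)
Lemma complete_bipartite_rainbow (G : graph T) (C : Type) (c : {set T} -> C)
    (S W : {set T}) :
  proper_colouring G c -> [disjoint S & W] -> #|S| = #|X| ->
  {in S & W, forall a w, adj G a w} -> 0 < #|S| ->
  (#|X| * #|X|.-1).+1 * #|Y|.-1 < #|W| ->
  has_rainbow_copy H G c.
Proof.
move=> prop disj cardS adjSW S_gt0 ltW.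
have diff e f : e \in edges G -> f \in edges G -> e != f -> forall z, z \in e ->
    z \in f -> c e <> c f.
  move=> eG fG ef z ze zf; apply: prop => //; apply/set0Pn; exists z.
  by rewrite inE ze zf.
have neq_pair a b w w' : a \in S -> b \in S -> w \in W -> w' \in W ->
    (a != b) || (w != w') -> [set a; w] != [set b; w'].
  move=> aS bS wW w'W; apply: contraTneq => eq_e; rewrite negb_or !negbK.
  have nSW x y : x \in S -> y \in W -> x == y = false.
    by move=> xS yW; apply/eqP => xy; rewrite -xy (disjointFr disj) in yW.
  apply/andP; split.
    have : a \in [set b; w'] by rewrite -eq_e !inE eqxx.
    by rewrite !inE (nSW a w') // orbF.
  have : w \in [set b; w'] by rewrite -eq_e !inE eqxx orbT.
  by rewrite !inE [w == b]eq_sym (nSW b w).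
(* The conflict relation. Colours live in an arbitrary type, so their equality is made boolean
   classically. *)
pose r w w' := [exists a in S, exists b in S :\ a,
  boolp.asbool (c [set a; w] = c [set b; w'])].
have rP w w' : reflect (exists a b, [/\ a \in S, b \in S, a != b &
    c [set a; w] = c [set b; w']]) (r w w').
  apply: (iffP existsP) => [[a /andP[aS /existsP[b]]]|[a [b [aS bS ab eq_c]]]].
    rewrite !inE => /andP[/andP[ba bS] /boolp.asboolP eq_c]; exists a, b.
    by rewrite eq_sym.
  exists a; rewrite aS; apply/existsP; exists b.
  by rewrite !inE eq_sym ab bS; apply/boolp.asboolP.
have rsym : symmetric r.
  by move=> w w'; apply/rP/rP => -[a [b [aS bS ab eq_c]]];
    exists b, a; rewrite eq_sym.
have degr : {in W, forall w, #|[set w' in W | r w w']| <= #|X| * #|X|.-1}.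
  move=> w wW; pose F a b :=
    [set w' in W | boolp.asbool (c [set a; w] = c [set b; w'])].
  apply: (@leq_trans #|\bigcup_(a in S) \bigcup_(b in S :\ a) F a b|).
    apply/subset_leq_card/subsetP=> w'; rewrite inE => /andP[w'W].
    move=> /rP[a [b [aS bS ab eq_c]]]; apply/bigcupP; exists a => //.
    apply/bigcupP; exists b; rewrite !inE ?bS 1?eq_sym ?ab // w'W.
    exact/boolp.asboolP.
  apply: leq_trans (card_bigcup_le _ _) _; rewrite -cardS -sum_nat_const.
  apply: leq_sum => a aS; apply: leq_trans (card_bigcup_le _ _) _.
  have -> : #|S|.-1 = \sum_(b in S :\ a) 1 by rewrite sum1_card (cardsD1 a S) aS.
  apply: leq_sum => b /setD1P[_ bS]; apply/card_le1P => w1.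
  rewrite inE => /andP[w1W /boolp.asboolP eq1] w2; rewrite !inE.
  apply/andP/eqP => [[w2W /boolp.asboolP eq2]|->]; last first.
    by split=> //; apply/boolp.asboolP.
  have [//|neq] := eqVneq w2 w1; case: (diff [set b; w1] [set b; w2] _ _ _ b).
  - by rewrite mem_edges ?adjSW.
  - by rewrite mem_edges ?adjSW.
  - by rewrite neq_pair // [w1 == _]eq_sym neq orbT.
  - by rewrite !inE eqxx.
  - by rewrite !inE eqxx.
  - by rewrite -eq1 eq2.
have [|L [LW cardL indL]] := @greedy_independent _ r _ #|Y| W rsym degr.
  case: #|Y| ltW => [|l] ltW; first by rewrite muln0 addnS.
  by rewrite mulnS addnC ltn_add2r.
have [t0 _] : exists t, t \in S by apply/card_gt0P.
have [f injf fS] : exists2 f : V -> T, {in X &, injective f} &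
    {in X, forall a, f a \in S} by apply: exists_injection; rewrite ?cardS.
have [g injg gL] : exists2 g : V -> T, {in Y &, injective g} &
    {in Y, forall a, g a \in L} by apply: exists_injection; rewrite ?cardL.
pose phi v := if v \in X then f v else g v.
have phiX x : x \in X -> phi x = f x by rewrite /phi => ->.
have phiY y : y \in Y -> phi y = g y.
  by rewrite bipartition_notin /phi => /negbTE->.
have gW y : y \in Y -> g y \in W by move=> /gL /(subsetP LW).
have fg x y : x \in X -> y \in Y -> f x <> g y.
  by move=> /fS xS /gW yW xy; rewrite -xy (disjointFr disj) in yW.
exists phi; split.
- move=> u v; have [uX|] := boolP (u \in X); have [vX|] := boolP (v \in X).
  + by rewrite !phiX //; apply: injf.
  + by rewrite -bipartition_notin => vY; rewrite phiX // phiY // => /fg [].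
  + rewrite -bipartition_notin => uY; rewrite [phi v]phiX // phiY //.
    by move/esym/fg; case.
  + by rewrite -!bipartition_notin => vY uY; rewrite !phiY //; apply: injg.
- move=> u v; rewrite -!mem_edges -imset_pair => /bipartition_edges[x [y [xX yY ->]]].
  by rewrite imset_pair mem_edges phiX // phiY // adjSW ?fS ?gW.
move=> e e' /bipartition_edges[x [y [xX yY ->]]].
move=> /bipartition_edges[x' [y' [x'X y'Y ->]]] neq.
rewrite !imset_pair !(phiX x) // !(phiX x') // !(phiY y) // !(phiY y') //.
(* Edges with a common end differ in colour by properness; disjoint edges differ because [L]
   contains no conflict. *)
have [eqx|nx] := eqVneq x x'; last have [eqy|ny] := eqVneq y y'.
- have ny : y != y' by apply: contraNneq neq => ->; rewrite eqx.
  subst x'; apply: (diff _ _ _ _ _ (f x));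
    rewrite ?mem_edges ?adjSW ?fS ?gW ?set21 ?set22 //.
  apply: neq_pair; rewrite ?fS ?gW //; apply/orP; right.
  by apply: contraNneq ny => /injg->.
- subst y'; apply: (diff _ _ _ _ _ (g y));
    rewrite ?mem_edges ?adjSW ?fS ?gW ?set21 ?set22 //.
  apply: neq_pair; rewrite ?fS ?gW //; apply/orP; left.
  by apply: contraNneq nx => /injf->.
- move=> eq_c; have gneq : g y != g y' by apply: contraNneq ny => /injg->.
  move/negP: (indL _ _ (gL _ yY) (gL _ y'Y) gneq); apply.
  apply/rP; exists (f x), (f x'); split; rewrite ?fS //.
  by apply: contraNneq nx => /injf->.
Qed.

End Bipartite.

(** * Cardinality facts, cones and the bound they give *)

Lemma subset_of_card (T : finType) (m : nat) :
  (m <= #|T|)%N -> exists K : {set T}, #|K| = m.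
Proof.
move=> /card_geqP[s [uniq_s size_s _]]; exists [set x in s].
by rewrite cardsE; move/card_uniqP: uniq_s => ->.
Qed.

Lemma card_neighbours (T : finType) (G : graph T) (v : T) :
  (#|neighbours G v| <= #|T|.-1)%N.
Proof.
rewrite -(cardC1 v); apply/subset_leq_card/subsetP=> w; rewrite !inE.
by apply: contraTneq => ->; rewrite adj_irr.
Qed.

Lemma independent_le_alpha (T : finType) (G : graph T) (S : {set T}) :
  independent G S -> (#|S| <= alpha G)%N.
Proof. by move=> indS; rewrite /alpha; apply: (bigop.bigmax_sup S). Qed.

Lemma bipartition_card (T : finType) (G : graph T) (X Y : {set T}) :
  bipartition G X Y -> #|T| = (#|X| + #|Y|)%N.
Proof.
case=> disj covXY _ _; rewrite -cardsT -covXY.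
by have [_] := leq_card_setU X Y; rewrite disj => /eqP.
Qed.

Section Cone.
Local Open Scope nat_scope.
Variables (T : finType) (K : {set T}).

(** The join of the complete graph on [K] with the empty graph on its complement. *)
Definition cone_rel : rel T :=
  fun u v => (u != v) && ((u \in K) || (v \in K)).

Lemma cone_sym : symmetric cone_rel.
Proof. by move=> u v; rewrite /cone_rel eq_sym orbC. Qed.

Lemma cone_irr : irreflexive cone_rel.
Proof. by move=> u; rewrite /cone_rel eqxx. Qed.

Definition cone : graph T := Graph cone_sym cone_irr.

(** Every edge of the cone meets [K], so in a copy of [H] the vertices sent outside [K] are
    independent; by injectivity there are more than [alpha H] of them. *)
Lemma cone_rainbow_free (V : finType) (H : graph V) :
  #|K| + alpha H < #|V| -> rainbow_free H cone.
Proof.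
move=> ltV; apply: rainbow_free_no_copy => phi inj hom.
suff /independent_le_alpha : independent H (~: (phi @^-1: K)).
  have := cardsCs (phi @^-1: K); have := max_card (mem (phi @^-1: K)).
  have : #|phi @^-1: K| <= #|K|.
    rewrite -(card_imset _ inj); apply/subset_leq_card/subsetP=> t.
    by case/imsetP=> v; rewrite inE => vK ->.
  by lia.
apply/forallP=> u; apply/implyP => uK; apply/forallP=> v; apply/implyP => vK.
apply/negP => /hom /andP[_]; rewrite !inE in uK vK.
by rewrite (negbTE uK) (negbTE vK).
Qed.

End Cone.

(** The degree sum is split over the k-1 core vertices, of degree at most n-1, and the others, which
    have at most k-1 neighbours in the core and at most (k(k-1)+1)(l-1) outside it. *)
Lemma sat_star_cone (V : finType) (H : graph V) (X Y : {set V}) (n : nat) :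
  bipartition H X Y -> #|Y| = alpha H -> (0 < #|X|)%N ->
  (#|X| + #|Y| <= n)%N ->
  exists2 m, is_sat_star n H m &
    (m.*2 <= #|X|.-1 * n.-1 + (n - #|X|.-1) *
      (#|X|.-1 + (#|X| * #|X|.-1).+1 * #|Y|.-1))%N.
Proof.
move=> bip alphaH X_gt0 n_ge.
have [|K cardK] := @subset_of_card 'I_n #|X|.-1; first by rewrite card_ord; lia.
have /saturated_extension[G satG subG] : rainbow_free H (cone K).
  by apply: cone_rainbow_free; rewrite (bipartition_card bip) cardK -alphaH; lia.
have [m satm lem] := is_sat_star_le satG; exists m => //.
rewrite -leq_double in lem; apply: leq_trans lem _.
apply: leq_trans (edges_le_sum_degrees G) _.
rewrite (bigID (mem K)) /=; apply: leq_add.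
  rewrite -cardK -sum_nat_const; apply: leq_sum => v _.
  by have := card_neighbours G v; rewrite card_ord.
have -> : (n - #|X|.-1 = #|~: K|)%N.
  by rewrite [RHS]cardsCs setCK card_ord cardK.
have inC v : (v \notin K) = (v \in ~: K) by rewrite inE.
rewrite -sum_nat_const (eq_bigl _ _ inC).
apply: leq_sum => v; rewrite inE => vK; rewrite -(cardsID K) leq_add //.
  by rewrite -cardK subset_leq_card ?subsetIr.
have [C [c [prop ncopy]]] := saturated_free satG.
(* [G] contains the cone, so [v |: K], of size k, is completely joined to the neighbours of [v]
   outside [K]; too many of these force a rainbow copy. *)
rewrite leqNgt; apply/negP => ltW; apply: ncopy.
apply: (@complete_bipartite_rainbow _ _ _ _ _ bip _ _ _ (v |: K) _ prop _ _ _ _ ltW).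
- apply/pred0P=> w /=; rewrite !inE.
  by case: eqVneq => [->|_] /=; [rewrite adj_irr andbF|case: (w \in K)].
- by rewrite cardsU1 vK cardK; lia.
- move=> a w; rewrite !inE => /orP[/eqP->|aK] /andP[wK Gvw] //; apply: subG.
  by rewrite /= /cone_rel aK andbT; apply: contraNneq wK => <-.
- by rewrite cardsU1 vK.
Qed.

(** * Stars with isolated vertices: rainbow-freeness as a degree bound *)

Section Stars.
Local Open Scope nat_scope.
Variables (V : finType) (H : graph V) (X Y : {set V}) (x : V).
Hypotheses (bipXY : bipartition H X Y) (X1 : X = [set x]).

Lemma star_edges (e : {set V}) : e \in edges H ->
  exists2 y, y \in neighbours H x & e = [set x; y].
Proof.
move=> eH; have [x' [y []]] := bipartition_edges bipXY eH.
by rewrite X1 inE => /eqP-> _ e_xy; exists y; rewrite // inE -mem_edges -e_xy.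
Qed.

Lemma card_star_edges : #|edges H| = #|neighbours H x|.
Proof.
rewrite -(card_in_imset (f := fun y => [set x; y])) => [|y z].
  apply: eq_card => e; apply/idP/imsetP => [/star_edges[y yN ->]|[y]].
    by exists y.
  by rewrite inE -mem_edges => ? ->.
rewrite !inE => Hxy Hxz eq_yz; have : y \in [set x; z] by rewrite -eq_yz set22.
by rewrite !inE => /orP[]/eqP // yx; rewrite yx adj_irr in Hxy.
Qed.

(** An edgeless [H] would be independent with |Y|+1 vertices, more than [alpha H]. *)
Lemma star_degree_gt0 : #|Y| = alpha H -> 0 < #|neighbours H x|.
Proof.
move=> alphaH; rewrite -card_star_edges card_gt0.
apply: contraT => /negPn/eqP E0.
have : independent H [set: V].
  apply/forallP=> u; apply/implyP => _; apply/forallP=> v; apply/implyP => _.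
  by rewrite -mem_edges E0 inE.
move/independent_le_alpha; rewrite cardsT (bipartition_card bipXY) X1 cards1.
by lia.
Qed.

Lemma star_degree_le : #|neighbours H x| <= #|Y|.
Proof.
apply/subset_leq_card/subsetP=> y; rewrite (bipartition_notin bipXY) X1 !inE.
by apply: contraTneq => ->; rewrite adj_irr.
Qed.

(** A vertex of larger degree is the centre of a copy of the star, rainbow since all its edges share
    that centre. The other vertices of [H] are isolated and go anywhere, which needs |V| <= |T|. *)
Lemma star_rainbow_free_degree (T : finType) (G : graph T) :
  #|V| <= #|T| -> rainbow_free H G ->
  forall v, #|neighbours G v| < #|neighbours H x|.
Proof.
move=> leVT [C [c [prop ncopy]]] v; rewrite ltnNge; apply/negP => deg_v.
apply: ncopy; have [f injf fN] := exists_injection v deg_v.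
have xN : x \notin neighbours H x by rewrite inE adj_irr.
have neq_v y : y \in neighbours H x -> f y != v.
  by move=> /fN; rewrite inE; apply: contraTneq => ->; rewrite adj_irr.
pose f' u := if u == x then v else f u.
have f'N : {in neighbours H x, f' =1 f}.
  by move=> y yN; rewrite /f'; case: eqVneq yN => // ->; rewrite (negbTE xN).
have injf' : {in x |: neighbours H x &, injective f'}.
  move=> y z; rewrite !in_setU1 => /orP[/eqP->|yN] /orP[/eqP->|zN] //.
  - rewrite (f'N z) // /f' eqxx => eq_v.
    by have := neq_v z zN; rewrite -eq_v eqxx.
  - rewrite (f'N y) // /f' eqxx => eq_v.
    by have := neq_v y yN; rewrite -eq_v eqxx.
  - by rewrite !f'N //; apply: injf.
have [phi inj_phi phiE] := injection_extension v injf' leVT.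
have phi_x : phi x = v by rewrite phiE ?setU11 // /f' eqxx.
have phi_N y : y \in neighbours H x -> adj G v (phi y).
  move=> yN; rewrite phiE; last by rewrite inE yN orbT.
  by rewrite f'N //; have := fN y yN; rewrite inE.
exists phi; split=> // [u w|e e'].
  rewrite -!mem_edges -imset_pair => /star_edges[y yN ->].
  by rewrite imset_pair phi_x mem_edges phi_N.
move=> /star_edges[y yN ->] /star_edges[z zN ->] neq.
rewrite !imset_pair phi_x; apply: prop; rewrite ?mem_edges ?phi_N //.
  rewrite -phi_x -!imset_pair; apply: contraNneq neq => eq_im.
  by apply/eqP; apply: imset_inj eq_im.
by apply/set0Pn; exists v; rewrite !inE eqxx.
Qed.

(** The converse: a copy of [H] would give the image of [x] too large a degree. *)
Lemma degree_rainbow_free (T : finType) (G : graph T) :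
  (forall v, #|neighbours G v| < #|neighbours H x|) -> rainbow_free H G.
Proof.
move=> degG; apply: rainbow_free_no_copy => phi inj hom.
have := degG (phi x); rewrite ltnNge => /negP; apply.
rewrite -(card_imset _ inj); apply/subset_leq_card/subsetP=> _ /imsetP[y + ->].
by rewrite !inE; apply: hom.
Qed.

End Stars.

(** * Circulant graphs *)

Section Circulant.
Local Open Scope nat_scope.
Variables (n m h : nat).

(* For m <= n, the vertices below m form a circulant graph in which each vertex
   misses the h nearest ones on both sides; the other vertices are isolated. *)
Definition circulant_rel : rel 'I_n := fun i j =>
  [&& i < m, j < m & h < (i - j) + (j - i) < m - h].

Lemma circulant_sym : symmetric circulant_rel.
Proof. by move=> i j; rewrite /circulant_rel andbCA addnC. Qed.

Lemma circulant_irr : irreflexive circulant_rel.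
Proof. by move=> i; rewrite /circulant_rel subnn !andbF. Qed.

Definition circulant : graph 'I_n := Graph circulant_sym circulant_irr.

Lemma card_ord_pred (P : pred nat) : #|[set i : 'I_n | P i]| = count P (iota 0 n).
Proof.
by rewrite -sum1dep_card -(big_mkord P (fun=> 1)) sum1_count /index_iota subn0.
Qed.

Lemma circulant_degree (i : 'I_n) : m <= n -> i < m ->
  #|neighbours circulant i| = m - (2 * h).+1.
Proof.
move=> le_mn lt_im.
pose P j := [&& i < m, j < m & h < (i - j) + (j - i) < m - h].
have -> : #|neighbours circulant i| = count P (iota 0 n) by exact: card_ord_pred.
(* The neighbours of [i] form two intervals, one above [i] and one below; truncated subtraction cuts
   them at [m] and at 0, and makes [(i - j) + (j - i)] the distance |i - j|. *)
pose s := iota (i + h).+1 (minn m (i + m - h) - (i + h).+1) ++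
          iota (i.+1 + h - m) (i - h - (i.+1 + h - m)).
have -> : count P (iota 0 n) = size s.
  rewrite -size_filter; apply/perm_size/uniq_perm.
  - by rewrite filter_uniq ?iota_uniq.
  - rewrite cat_uniq !iota_uniq /= andbT; apply/hasPn => j.
    by rewrite !mem_iota; lia.
  - move=> j; rewrite mem_filter mem_cat !mem_iota /P.
    apply/idP/idP => [/andP[/and3P[? ? /andP[? ?]]]|];
      last case/orP => /andP[? ?]; lia.
by rewrite size_cat !size_iota; lia.
Qed.

End Circulant.

(** * Upper bounds for stars *)

Section StarSaturation.
Local Open Scope nat_scope.
Variables (V : finType) (H : graph V) (X Y : {set V}) (x : V) (n : nat).
Hypotheses (bipXY : bipartition H X Y) (X1 : X = [set x]).
Hypotheses (alphaH : #|Y| = alpha H) (n_gt : #|Y| < n).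

Lemma saturated_star_degree (G : graph 'I_n) : properly_rainbow_saturated H G ->
  forall v, #|neighbours G v| < #|neighbours H x|.
Proof.
move/saturated_free; apply: star_rainbow_free_degree bipXY X1 _ _ _.
by rewrite (bipartition_card bipXY) X1 cards1 card_ord.
Qed.

(** Extending the empty graph suffices: all degrees stay at most l-2, and n(l-2) <= (l-1)(n-1) since
    l < n. *)
Lemma sat_star_few_leaves : #|neighbours H x| < #|Y| ->
  exists2 m, is_sat_star n H m & m.*2 <= #|Y|.-1 * n.-1.
Proof.
move=> ltY; have deg_gt0 := star_degree_gt0 bipXY X1 alphaH.
have /saturated_extension[G satG _] : rainbow_free H (cone (set0 : {set 'I_n})).
  apply: (@degree_rainbow_free _ _ x) => v.
  rewrite (_ : neighbours _ v = set0) ?cards0 //; apply/setP=> w.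
  by rewrite !inE /= /cone_rel !inE andbF.
have [m satm lem] := is_sat_star_le satG; exists m => //.
rewrite -leq_double in lem; apply: leq_trans lem _.
apply: leq_trans (edges_le_sum_degrees G) _.
apply: (@leq_trans (\sum_(v : 'I_n) #|Y|.-2)).
  by apply: leq_sum => v _; have := saturated_star_degree satG v; lia.
rewrite sum_nat_const card_ord; case: #|Y| ltY n_gt => [|[|l]] //= _ lt_n.
  by move: lt_n deg_gt0; lia.
by case: n lt_n => // n' lt_n; rewrite mulSn mulSn mulnC; lia.
Qed.

(** The circulant vertices already have the largest allowed degree l-1, so a saturated extension can
    only add an edge between the remaining one or two vertices. *)
Lemma sat_star_all_leaves : #|neighbours H x| = #|Y| ->
  (#|Y| = 2 -> odd n) ->
  exists2 m, is_sat_star n H m & m.*2 <= #|Y|.-1 * n.-1.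
Proof.
move=> degx l2_odd; have := n_gt; set l := #|Y| in degx l2_odd * => lt_ln.
have l_gt0 : 0 < l by rewrite -degx (star_degree_gt0 bipXY X1 alphaH).
(* The circulant on p vertices has degree l-1 for p = 2h + l, which is n-1 or n-2. *)
pose h := (n.-1 - l)./2; pose p := 2 * h + l.
have [le_pn le_np] : p < n /\ n <= p.+2 by rewrite /p /h; lia.
pose G0 := @circulant n p h.
have degG0 (v : 'I_n) : v < p -> #|neighbours G0 v| = l.-1.
  by move=> ltv; rewrite circulant_degree //; rewrite /p; lia.
have /saturated_extension[G satG subG] : rainbow_free H G0.
  apply: (@degree_rainbow_free _ _ x) => v; rewrite degx.
  have [ltv|lev] := ltnP v p; first by rewrite degG0 //; lia.
  rewrite (_ : neighbours _ v = set0) ?cards0 //; apply/setP=> w.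
  by rewrite !inE /= /circulant_rel ltnNge lev.
have degG v : #|neighbours G v| <= l.-1.
  by have := saturated_star_degree satG v; rewrite degx; lia.
(* Inclusion together with the degree bound forces equality. *)
have NG (v : 'I_n) : v < p -> neighbours G v = neighbours G0 v.
  move=> ltv; apply/eqP; rewrite eq_sym eqEcard degG0 // degG andbT.
  by apply/subsetP=> w; rewrite !inE; apply: subG.
have card_last : #|[set i : 'I_n | p <= i]| = n - p.
  rewrite card_ord_pred -size_filter -[RHS](size_iota p).
  apply/perm_size/uniq_perm; rewrite ?filter_uniq ?iota_uniq // => j.
  by rewrite mem_filter !mem_iota; lia.
have card_first : #|[set i : 'I_n | i < p]| = p.
  have := cardsC [set i : 'I_n | i < p]; rewrite card_ord.
  have -> : ~: [set i : 'I_n | i < p] = [set i : 'I_n | p <= i].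
    by apply/setP=> i; rewrite !inE -leqNgt.
  by rewrite card_last; lia.
have degG_last (v : 'I_n) : p <= v -> #|neighbours G v| <= minn l.-1 (n - p).-1.
  move=> lev; rewrite leq_min degG /= -card_last.
  have := cardsD1 v [set i : 'I_n | p <= i]; rewrite inE lev => ->.
  apply/subset_leq_card/subsetP=> w; rewrite inE => Gvw; rewrite in_setD1 inE.
  apply/andP; split; first by apply: contraTneq Gvw => ->; rewrite adj_irr.
  rewrite leqNgt; apply/negP => /NG; move/setP/(_ v); rewrite !inE adj_sym Gvw.
  by rewrite /= /circulant_rel [v < p]ltnNge lev /= andbF.
have [m satm lem] := is_sat_star_le satG; exists m => //.
rewrite -leq_double in lem; apply: leq_trans lem _.
apply: leq_trans (edges_le_sum_degrees G) _.
apply: (@leq_trans (p * l.-1 + (n - p) * minn l.-1 (n - p).-1)).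
  rewrite (bigID (fun v : 'I_n => v < p)) /=; apply: leq_add.
    rewrite -[X in X * _]card_first cardsE -sum_nat_const.
    by apply: leq_sum => v _; apply: degG.
  under eq_bigl do rewrite -leqNgt.
  rewrite -[X in X * _]card_last cardsE -sum_nat_const.
  by apply: leq_sum => v; apply: degG_last.
have [np|np] : n = p.+1 \/ n = p.+2 by move: le_pn le_np; lia.
  by rewrite np subSn // subnn minn0 muln0 addn0 mulnC.
(* With two vertices left, the bound needs 2 min(l-1, 1) <= l-1, which fails only for l = 2; but
   then [n] is odd and p = n-1. *)
have l2 : l <> 2 by move=> l2; move: (l2_odd l2) np; rewrite /p /h; lia.
rewrite np (_ : p.+2 - p = 2); last by lia.
case: (l) l_gt0 l2 => [|[|[|l']]] //= _ _; first by rewrite muln0.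
by rewrite mulnC mulnS addnC leq_add2r; lia.
Qed.

End StarSaturation.

(* Without the hypothesis X_gt0 the graph H may be edgeless, and then sat^* is
   undefined; without not_P3_even the inequality is false, since
   sat^*(n, P_3) = n / 2 > (n - 1) / 2 for n even. *)
Theorem theorem3p6 (V : finType) (H : graph V) (X Y : {set V}) (k l n : nat)
  (bipXY : bipartition H X Y) (cardX : #|X| = k) (cardY : #|Y| = l)
  (alphaH : l = alpha H) (X_gt0 : (0 < k)%N)
  (not_P3_even : ~ [/\ k = 1%N, l = 2%N, #|edges H| = 2%N & ~~ odd n])
  (n_ge : (k + l <= n)%N) :
  exists2 m : nat, is_sat_star n H m &
    (m%:R : rat) <=
      (k%:R - 1 + (k%:R * (k%:R - 1) + 1) * (l%:R - 1) / 2) * n%:R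
      - ((k%:R * (k%:R - 1) ^+ 2 + 1) * (l%:R - 1) + k%:R * (k%:R - 1)) / 2.
Proof.
have l_gt0 : (0 < l)%N.
  have [x _] : exists x, x \in X by apply/card_gt0P; rewrite cardX.
  rewrite alphaH -(cards1 x) independent_le_alpha //.
  apply/forallP=> u; apply/implyP => /set1P->; apply/forallP=> v.
  by apply/implyP => /set1P->; rewrite adj_irr.
have [l' l_eq] : exists l', l = l'.+1 by exists l.-1; rewrite prednK.
have alphaY : #|Y| = alpha H by rewrite cardY.
(* For k = 1 the claimed bound is (l-1)(n-1)/2. *)
have [k1|k_neq1] := eqVneq k 1%N.
  have [x X1] : exists x, X = [set x] by apply/cards1P; rewrite cardX k1.
  have n_gt : (#|Y| < n)%N by rewrite cardY -add1n -k1.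
  have [m satm lem] : exists2 m, is_sat_star n H m & (m.*2 <= #|Y|.-1 * n.-1)%N.
    have := star_degree_le bipXY X1; rewrite leq_eqVlt => /orP[/eqP degx|].
      apply: (sat_star_all_leaves bipXY X1) => // l2.
      apply/negPn/negP => n_even; apply: not_P3_even.
      by rewrite (card_star_edges bipXY X1) degx -cardY.
    exact: (sat_star_few_leaves bipXY X1).
  have [n' n_eq] : exists n', n = n'.+1 by exists n.-1; lia.
  exists m => //; move: lem; rewrite cardY k1 l_eq n_eq !succnK.
  rewrite -(ler_nat rat) -muln2 !natrM -(natr1 l') -(natr1 n') => lem.
  by lra.
have X_pos : (0 < #|X|)%N by rewrite cardX.
have XY_le : (#|X| + #|Y| <= n)%N by rewrite cardX cardY.
have [m satm lem] := sat_star_cone bipXY alphaY X_pos XY_le.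
have [k' k_eq] : exists k', k = k'.+2 by exists k.-2; lia.
(* This form of [n] removes the truncated subtractions before the cast to rationals. *)
have [p n_eq] : exists p, n = (k'.+1 + p.+1)%N by exists (n - k'.+2)%N; lia.
exists m => //; move: lem; rewrite cardX cardY k_eq l_eq n_eq addnS !succnK.
rewrite -addnS addKn -(ler_nat rat) -muln2 !(natrM, natrD, =^~ natr1).
(* Twice the claimed bound exceeds the degree sum bound of the cone by exactly (k-2)(l-1), which is
   this product. For k = 1 and l > 1 that difference is negative, hence the separate treatment of
   stars. *)
have : 0 <= (k'%:R : rat) * l'%:R by rewrite mulr_ge0.
by rewrite add0r (_ : 1 + 1 = 2) //; lra.
Qed.
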